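(* For every positive integer $m$, the orbit Cayley graph $Cay(Z_2^{4m},S_2\cup S_3)$ is strongly regular with parameters $$\left(2^{4m},\;2^{4m-1}-(-1)^m2^{2m-1},\;2^{4m-2}-(-1)^m2^{2m-1},\;2^{4m-2}-(-1)^m2^{2m-1}\right).$$
   Context: $Z_2^n$ is the elementary abelian $2$-group of rank $n$, viewed as the vector space $F_2^n$; here $n=4m$. For $v\in Z_2^n$, $|v|$ is the number of coordinates equal to $1$, and $O_i=\{v\in Z_2^n : |v|=i\}$ for $0\le i\le n$. Set $S_0=\bigcup_{i\neq 0,\ i\equiv 0 \,(\mathrm{mod}\ 4)}O_i$ and, for $a\in\{1,2,3\}$, $S_a=\bigcup_{i\equiv a\,(\mathrm{mod}\ 4)}O_i$, with $0\le i\le n$. For a group $G$ and $S\subseteq G$ with $1\notin S$ and $S=S^{-1}$, the Cayley graph $Cay(G,S)$ has vertex set $G$, with $x,y$ adjacent iff $x^{-1}y\in S$; it is called an orbit Cayley graph over $Z_2^n$ if $G=Z_2^n$ and $S$ is a union of some of the $O_i$. A strongly regular graph with parameters $(N,r,\lambda,\mu)$ is a connected $r$-regular graph on $N$ vertices in which any two adjacent vertices have exactly $\lambda$ common neighbours and any two distinct non-adjacent vertices have exactly $\mu$ common neighbours. *)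

(* Defs.v *)
From mathcomp Require Import all_boot all_order all_algebra all_fingroup.

Set Implicit Arguments.
Unset Strict Implicit.
Unset Printing Implicit Defensive.

Import GRing.Theory.
Local Open Scope ring_scope.

(* The parameters are integers, so that subtraction in closed formulas for them
   is not truncated. *)
Definition strongly_regular (T : finType) (e : rel T) (N r lambda mu : int)
    : Prop :=
  (symmetric e /\ irreflexive e) /\
  [/\ forall x y, connect e x y,
      #|T| = N :> int,
      forall x, #|[set y | e x y]| = r :> int,
      forall x y, e x y -> #|[set z | e x z && e y z]| = lambda :> int
    & forall x y, x != y -> ~~ e x y ->
        #|[set z | e x z && e y z]| = mu :> int].

Section Cayley.
Variable gT : finGroupType.
Local Open Scope group_scope.

Definition connection_set (S : {set gT}) : Prop := 1 \notin S /\ S^-1 = S.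

Definition Cay (S : {set gT}) : rel gT := fun x y => x^-1 * y \in S.

End Cayley.

(* The group law of this type is vector addition. *)
Notation Z2 n := 'rV['F_2]_n.

Definition weight (n : nat) (v : Z2 n) : nat := #|[set j | v 0 j == 1]|.

Definition orbit_O (n i : nat) : {set Z2 n} := [set v | weight v == i].

Definition orbit_connection_set (n : nat) (S : {set Z2 n}) : Prop :=
  connection_set S /\ exists I : {set 'I_n.+1}, S = \bigcup_(i in I) orbit_O n i.

(* The condition i != 0 only matters for a = 0. *)
Definition S_mod4 (n a : nat) : {set Z2 n} :=
  \bigcup_(i < n.+1 | ((i : nat) != 0%N) && (i == a %[mod 4])) orbit_O n i.

(* Main.v *)
Require Import Defs.
From mathcomp Require Import all_boot all_order all_algebra all_fingroup.
From mathcomp Require Import zify ring lra.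

Import Order.TTheory GRing.Theory Num.Theory.
Local Open Scope ring_scope.

(** An element [v] of weight [w] lies in S_2 or S_3 exactly when the binary digit
    of [w] of value 2 is set, that is, when 'C(w, 2) is odd.  Since 'C(w, 2) counts
    the pairs of coordinates at which [v] is 1, its parity is the quadratic form
    [qform v] = \sum_(i < j) v_i v_j over F_2, with the alternating polar form
    [polar x y] = \sum_(i != j) x_i y_j = w(x) w(y) + x.y.  So the connection set
    is the set where [qform] is 1, and everything follows from two sums of
    the signs s(v) = (-1) ^ qform v.

    - When n is even the polar form is nondegenerate ([polar_nondegenerate]), so
      [qform] is a bent function: for d != 0 the sum of s(z) s(z + d) over z
      vanishes ([qform_autocorrelation]).
    - Splitting off one coordinate at a time gives a recursion for the sum of all
      s(v), with value (-4)^m for n = 4m ([sum_qform]); this is the real part of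
      (1 - i) (1 + i)^n.

    Writing the indicator of the connection set as (1 - s) / 2, the degree is
    (2^n - (-4)^m) / 2.  The number of common neighbours of x and y is a quarter
    of the sum of (1 - s(x + z)) (1 - s(y + z)); the product of signs contributes
    0 as soon as x != y, so this number is (2^n - 2 (-4)^m) / 4 whether or not x
    and y are adjacent.  It is positive, which gives connectedness. *)

(** * Weights and the quadratic form *)

Definition hadamard {n} (x y : Z2 n) : Z2 n := \row_j (x 0 j * y 0 j).

(** [w./2] has the parity of 'C(w, 2), so this is \sum_(i < j) v_i v_j in F_2. *)
Definition qform {n} (v : Z2 n) : bool := odd (weight v)./2.

(** The form \sum_(i != j) x_i y_j: all pairs (i, j), minus the diagonal. *)
Definition polar {n} (x y : Z2 n) : bool :=
  (odd (weight x) && odd (weight y)) (+) odd (weight (hadamard x y)).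

Lemma F2_cases (a : 'F_2) : a = 0 \/ a = 1.
Proof. by case: a => [[|[|//]] lt]; [left | right]; apply: val_inj. Qed.

Lemma oppZ2 {n} (x : Z2 n) : - x = x.
Proof.
by apply/rowP=> j; rewrite mxE; case: (F2_cases (x 0 j)) => ->; apply: val_inj.
Qed.

Lemma weightE {n} (v : Z2 n) : weight v = (\sum_j (v 0%R j == 1%R))%N.
Proof.
by rewrite /weight -sum1dep_card big_mkcond; apply: eq_bigr => j _; case: eqP.
Qed.

Lemma weight0 n : weight (0 : Z2 n) = 0%N.
Proof. by rewrite weightE big1 // => j _; rewrite mxE. Qed.

Lemma weight_le {n} (v : Z2 n) : (weight v <= n)%N.
Proof. by rewrite -[X in (_ <= X)%N]card_ord max_card. Qed.

(** Inclusion-exclusion on supports. It is an identity of natural numbers, so it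
    carries the second binary digit of the weights, not only their parity. *)
Lemma weightD {n} (x y : Z2 n) :
  (weight (x + y) + (weight (hadamard x y)).*2 = weight x + weight y)%N.
Proof.
rewrite !weightE -muln2 big_distrl -!big_split; apply: eq_bigr => j _ /=.
by rewrite !mxE; case: (F2_cases (x 0 j)) => ->; case: (F2_cases (y 0 j)) => ->.
Qed.

Lemma odd_weightD {n} (x y : Z2 n) :
  odd (weight (x + y)) = odd (weight x) (+) odd (weight y).
Proof. by rewrite -oddD -weightD oddD odd_double addbF. Qed.

Lemma hadamardDl {n} (x y z : Z2 n) :
  hadamard (x + y) z = hadamard x z + hadamard y z.
Proof. by apply/rowP=> j; rewrite !mxE mulrDl. Qed.

(** Halve [weightD]: on the right, two odd weights produce a carry, which is the
    term w(x) w(y) of the polar form. *)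
Lemma qformD {n} (x y : Z2 n) :
  qform (x + y) = qform x (+) qform y (+) polar x y.
Proof.
have /(congr1 (fun k => odd k./2)) := weightD x y.
rewrite !halfD odd_double andbF add0n doubleK !oddD /qform /polar oddb.
by do 6!case: (odd _).
Qed.

Lemma polarDl {n} (x y z : Z2 n) :
  polar (x + y) z = polar x z (+) polar y z.
Proof.
by rewrite /polar hadamardDl !odd_weightD; do 6!case: (odd _).
Qed.

Lemma polar_delta {n} (j : 'I_n) (y : Z2 n) :
  polar (delta_mx 0 j) y = odd (weight y) (+) (y 0 j == 1).
Proof.
have wt1 (v : Z2 n) : (forall k, k != j -> v 0 k = 0) ->
    weight v = (v 0 j == 1) :> nat.
  by move=> v0; rewrite weightE (bigD1 j) //= big1 ?addn0 // => k /v0 ->.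
rewrite /polar (wt1 (delta_mx _ _)) => [|k /negPf kj]; last by rewrite mxE kj andbF.
rewrite (wt1 (hadamard _ _)) => [|k /negPf kj]; last by rewrite !mxE kj andbF mul0r.
by rewrite !mxE !eqxx mul1r !oddb.
Qed.

(** By [polar_delta] a witness among the unit vectors exists unless every
    coordinate of [y] equals the parity of its weight. Then [y] is 0, or it is the
    all-ones vector, whose weight n would have to be odd. *)
Lemma polar_nondegenerate {n} (y : Z2 n) :
  ~~ odd n -> y != 0 -> exists e, polar e y.
Proof.
move=> n_even y_neq0; suff [j yj] : exists j, (y 0 j == 1) != odd (weight y).
  by exists (delta_mx 0 j); rewrite polar_delta addbC -negb_eqb.
apply/existsP; apply: contraR y_neq0; rewrite negb_exists => /forallP y_const.
have yE j : (y 0 j == 1) = odd (weight y).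
  by have /negPn/eqP := y_const j.
have wt_even : odd (weight y) = false.
  apply: contraNF n_even => wt_odd; suff wt_n : weight y = n by rewrite -[n]wt_n.
  rewrite weightE (eq_bigr (fun=> 1%N)) ?sum1_card ?card_ord // => j _.
  by rewrite yE wt_odd.
apply/eqP/rowP=> j; rewrite mxE; have := yE j; rewrite wt_even.
by case: (F2_cases (y 0 j)) => ->.
Qed.

(** * Sums of signs *)

(** s(z) s(z + d) is s(d) times the character z |-> (-1) ^ polar z d, which is
    nontrivial by nondegeneracy: translating z by some e with [polar e d] negates
    every term of the sum. *)
Lemma qform_autocorrelation {n} (d : Z2 n) : ~~ odd n -> d != 0 ->
  \sum_z (-1) ^+ qform z * (-1) ^+ qform (z + d) = 0 :> int.
Proof.
move=> n_even d_neq0; have [e ped] := polar_nondegenerate d n_even d_neq0.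
set s := \sum_z _; suff : s = - s by lia.
rewrite {1}/s (reindex_inj (addIr e)) /= /s -sumrN; apply: eq_bigr => z _.
rewrite -!signr_addb -signrN [z + e + d]addrAC.
congr (_ ^+ _); congr nat_of_bool.
rewrite !(qformD _ e) polarDl.
have -> : polar d e = polar e d.
  rewrite /polar andbC; congr (_ (+) odd (weight _)).
  by apply/rowP=> j; rewrite !mxE mulrC.
by rewrite ped addbT; do 3!case: (qform _); case: (polar z e).
Qed.

(** Split off the first coordinate: the two sums are its values 0 and 1. *)
Lemma sum_weightS {n} (g : nat -> int) :
  \sum_(v : Z2 n.+1) g (weight v) =
  \sum_(v : Z2 n) g (weight v) + \sum_(v : Z2 n) g (weight v).+1.
Proof.
pose h (p : 'F_2 * Z2 n) : Z2 (1 + n) := row_mx (const_mx p.1) p.2.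
rewrite (reindex h) /=; last first.
  exists (fun v : Z2 (1 + n) => (lsubmx v 0 0, rsubmx v)) => [[a v] _|v _].
    by rewrite /h /= row_mxKl row_mxKr mxE.
  rewrite /h /=; have -> : const_mx (lsubmx v 0 0) = lsubmx v.
    by apply/rowP=> j; rewrite !mxE ord1.
  exact: hsubmxK.
rewrite -(pair_bigA _ (fun a v => g (weight (h (a, v))))) /=.
rewrite big_ord_recl big_ord1.
have wth a v : weight (h (a, v)) = ((a == 1%R) + weight v)%N.
  rewrite !weightE (@big_split_ord _ _ _ 1) big_ord1 /h /=.
  rewrite row_mxEl mxE; congr addn.
  by apply: eq_bigr => j _; rewrite row_mxEr.
by congr (_ + _); apply: eq_bigr => v _; rewrite wth.
Qed.

(** The sums W k n of the signs of the shifted weights w + k satisfy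
    W k (n + 1) = W k n + W (k + 1) n and W (k + 2) n = - W k n. The shift k thus
    acts as a square root i of -1, one coordinate multiplies by 1 + i, and four
    coordinates multiply by (1 + i)^4 = -4. *)
Lemma sum_qform m : \sum_(v : Z2 (4 * m)) (-1) ^+ qform v = (-4) ^+ m :> int.
Proof.
pose g k (w : nat) : int := (-1) ^+ odd (w + k)./2.
pose W k n : int := \sum_(v : Z2 n) g k (weight v).
have WS k n : W k n.+1 = W k n + W k.+1 n.
  rewrite /W sum_weightS; congr (_ + _); apply: eq_bigr => v _.
  by rewrite /g addSnnS.
have W2 k n : W k.+2 n = - W k n.
  rewrite /W -sumrN; apply: eq_bigr => v _.
  by rewrite /g !addnS /= signrN.
suff : W 0%N (4 * m)%N = (-4) ^+ m.
  by move <-; apply: eq_bigr => v _; rewrite /g addn0.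
elim: m => [|m IHm].
  rewrite muln0 expr0 /W (big_pred1 0) ?weight0 // => v.
  by apply/esym/eqP/rowP=> -[].
rewrite mulnS !WS !W2 exprS -IHm; ring.
Qed.

(** * The connection set and its Cayley graph *)

Lemma mem_S_mod4 n a (v : Z2 n) :
  (v \in S_mod4 n a) = (weight v != 0%N) && (weight v == a %[mod 4]).
Proof.
apply/bigcupP/idP => [[i ia]|va]; first by rewrite inE => /eqP->.
by exists (Ordinal (weight_le v : (weight v < n.+1)%N)); rewrite ?inE.
Qed.

Lemma S2_S3_qform n : S_mod4 n 2 :|: S_mod4 n 3 = [set v | qform v].
Proof.
apply/setP=> v; rewrite !inE !mem_S_mod4 /qform.
move: (weight v) => w.
have -> : odd w./2 = odd (w %% 4)./2.
  have {1}-> : (w = (w %/ 4).*2.*2 + w %% 4)%N by lia.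
  by rewrite halfD odd_double doubleK add0n oddD odd_double.
(* A residue 2 or 3 forces w != 0: expose the remainder in this condition. *)
have -> : (w != 0 = (w %/ 4 != 0) || (w %% 4 != 0))%N by lia.
have := ltn_pmod w (isT : 0 < 4)%N.
by case: (w %% 4)%N => [|[|[|[|//]]]] _; rewrite ?orbT ?andbF ?orbF.
Qed.

Lemma qform_orbit_connection n : orbit_connection_set [set v : Z2 n | qform v].
Proof.
split.
  split; first by rewrite inE /qform weight0.
  by apply/setP=> v; rewrite !inE /= -[in RHS](oppZ2 v).
exists [set i : 'I_n.+1 | odd i./2]; apply/setP=> v; rewrite inE.
apply/idP/bigcupP => [qv|[i]]; last by rewrite !inE => qi /eqP vi; rewrite /qform vi.
by exists (Ordinal (weight_le v : (weight v < n.+1)%N)); rewrite inE.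
Qed.

(** Differences are sums in characteristic 2. *)
Lemma CayE {n} (x y : Z2 n) : Cay [set v | qform v] x y = qform (x + y).
Proof. by rewrite /Cay inE -[in RHS](oppZ2 x). Qed.

Lemma sign_indicator (b : bool) : (-1) ^+ b = 1 - 2 * b%:Z.
Proof. by case: b. Qed.

Lemma card_indicator (T : finType) (P : pred T) :
  #|[set x | P x]| = \sum_x (P x)%:Z :> int.
Proof.
rewrite -sum1dep_card big_mkcond -natz natr_sum.
by apply: eq_bigr => x _; case: (P x).
Qed.

Lemma sum1_Z2 n : \sum_(v : Z2 n) 1 = 2 ^+ n :> int.
Proof. by rewrite sumr_const card_mx card_Fp // mul1n -natrX. Qed.

Lemma card_nbrs {n} (x : Z2 n) :
  2 * #|[set y | Cay [set v | qform v] x y]|%:Z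
  = 2 ^+ n - \sum_(v : Z2 n) (-1) ^+ qform v.
Proof.
rewrite card_indicator -sum1_Z2 -sumrB (reindex_inj (addrI (- x))) mulr_sumr /=.
apply: eq_bigr => v _; rewrite CayE addrA subrr add0r sign_indicator; ring.
Qed.

(** Expand the sum of (1 - s(x + z)) (1 - s(y + z)): the product of signs sums to 0
    and each linear term, after a translation, is the sum of all signs. The answer
    is the same for all pairs x != y, whence lambda = mu. *)
Lemma card_common_nbrs {n} (x y : Z2 n) : ~~ odd n -> x != y ->
  4 * #|[set z | Cay [set v | qform v] x z && Cay [set v | qform v] y z]|%:Z
  = 2 ^+ n - 2 * \sum_(v : Z2 n) (-1) ^+ qform v.
Proof.
move=> n_even neq_xy.
have shift a : \sum_(v : Z2 n) (-1) ^+ qform (a + v)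
    = \sum_(v : Z2 n) (-1) ^+ qform v :> int.
  by rewrite [RHS](reindex_inj (addrI a)).
(* Translating by x turns the product of signs into an autocorrelation. *)
have cross : \sum_(z : Z2 n) (-1) ^+ qform (x + z) * (-1) ^+ qform (y + z) = 0 :> int.
  rewrite -[RHS](qform_autocorrelation (y - x) n_even) ?subr_eq0 1?eq_sym //.
  rewrite [RHS](reindex_inj (addrI x)); apply: eq_bigr => z _.
  by rewrite [x + z + _]addrC addrA subrK.
rewrite card_indicator mulr_sumr.
transitivity (\sum_(z : Z2 n) (1 - (-1) ^+ qform (x + z) - (-1) ^+ qform (y + z)
    + (-1) ^+ qform (x + z) * (-1) ^+ qform (y + z)) : int).
  by apply: eq_bigr => z _; rewrite !CayE; do 2!case: qform.
by rewrite big_split !sumrB /= cross !shift sum1_Z2; ring.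
Qed.

Theorem corollary3 (m : nat) (hm : (0 < m)%N) :
  let S := S_mod4 (4 * m) 2 :|: S_mod4 (4 * m) 3 in
  orbit_connection_set S /\
  strongly_regular (Cay S)
    (2 ^+ (4 * m))
    (2 ^+ (4 * m - 1) - (-1) ^+ m * 2 ^+ (2 * m - 1))
    (2 ^+ (4 * m - 2) - (-1) ^+ m * 2 ^+ (2 * m - 1))
    (2 ^+ (4 * m - 2) - (-1) ^+ m * 2 ^+ (2 * m - 1)).
Proof.
move=> S; rewrite {}/S S2_S3_qform; split; first exact: qform_orbit_connection.
set S := [set v | _].
have n_even : ~~ odd (4 * m) by rewrite oddM.
have loopless x : Cay S x x = false.
  by rewrite CayE -{2}[x]oppZ2 subrr /qform weight0.
set c : int := 2 ^+ (4 * m - 2) - (-1) ^+ m * 2 ^+ (2 * m - 1).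
have pow4 : 2 ^+ (4 * m) = 4 * 2 ^+ (4 * m - 2) :> int.
  by rewrite -(exprD 2 2) subnKC //; lia.
have pow2 : 2 ^+ (4 * m - 1) = 2 * 2 ^+ (4 * m - 2) :> int.
  by rewrite -exprS; congr (_ ^+ _); lia.
have sumE : (-4) ^+ m = 2 * ((-1) ^+ m * 2 ^+ (2 * m - 1)) :> int.
  rewrite (_ : -4 = -1 * 2 ^+ 2) // exprMn -exprM mulrCA -exprS.
  by congr (_ * _ ^+ _); lia.
have common x y : x != y -> #|[set z | Cay S x z && Cay S y z]| = c :> int.
  move=> /(card_common_nbrs x y n_even); rewrite sum_qform pow4 sumE /c -/S; lra.
(* Any two vertices then have a common neighbour, so the diameter is at most 2. *)
have c_gt0 : 0 < c.
  have lt_pow : 2 ^+ (2 * m - 1) < 2 ^+ (4 * m - 2) :> int.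
    by rewrite ltr_eXn2l //; lia.
  rewrite subr_gt0 (le_lt_trans (ler_norm _)) //.
  by rewrite normrMsign ger0_norm ?exprn_ge0.
split; first split.
- by move=> x y; rewrite !CayE addrC.
- exact: loopless.
split.
- move=> x y; have [->|neq_xy] := eqVneq x y; first exact: connect0.
  have : (0 < #|[set z | Cay S x z && Cay S y z]|)%N by rewrite -ltz_nat common.
  case/card_gt0P=> z; rewrite inE => /andP[xz yz].
  apply: (connect_trans (connect1 xz)); apply: connect1.
  by rewrite CayE addrC -CayE.
- by rewrite card_mx card_Fp // mul1n -natz natrX.
- move=> x; have := card_nbrs x; rewrite sum_qform pow4 pow2 sumE -/S; lra.
- by move=> x y exy; apply: common; apply: contraTneq exy => ->; rewrite loopless.
- by move=> x y neq_xy _; apply: common.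
Qed.
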